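(* Let $(W,S)$ be a Coxeter system with $W$ finite, and let $S=I\cup J$ where no element of $I$ is conjugate in $W$ to an element of $J$. Let $\widetilde J=\{wsw^{-1} : w\in W_I,\ s\in J\}$ and let $\widetilde W$ be the subgroup of $W$ generated by $\widetilde J$, so that $(\widetilde W,\widetilde J)$ is a Coxeter system. Let $\widetilde{\mathrm{Res}}\colon\Sigma(W)\to\Sigma(\widetilde W)$ be the $\mathbb Q$-linear map defined by $$\widetilde{\mathrm{Res}}(x_K)=\sum_{d\in X^I_{I\cap K}}\tilde x_{\widetilde J\cap dW_Kd^{-1}}\qquad(K\subseteq S).$$ Then $\widetilde{\mathrm{Res}}$ is a morphism of $\mathbb Q$-algebras.
   Context: For $K\subseteq S$, $W_K$ is the subgroup of $W$ generated by $K$, $X_K$ is the set of $w\in W$ which have minimal length in $wW_K$, and $x_K=\sum_{w\in X_K}w\in\mathbb QW$. For $C\subseteq I$, $X^I_C$ is the set of $x\in W_I$ which have minimal length in $xW_C$. For $L\subseteq\widetilde J$, $\widetilde W_L$ is the subgroup of $\widetilde W$ generated by $L$, $\widetilde X_L$ is the set of $w\in\widetilde W$ which have minimal length (with respect to $(\widetilde W,\widetilde J)$) in $w\widetilde W_L$, and $\tilde x_L=\sum_{w\in\widetilde X_L}w\in\mathbb Q\widetilde W$. The Solomon descent algebras are $\Sigma(W)=\bigoplus_{K\subseteq S}\mathbb Qx_K$ and $\Sigma(\widetilde W)=\bigoplus_{L\subseteq\widetilde J}\mathbb Q\tilde x_L$; they are subalgebras of the group algebras $\mathbb QW$ and $\mathbb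 Q\widetilde W$ respectively (Solomon). *)

(* Defs.v *)
From mathcomp Require Import all_boot all_fingroup all_algebra.
From mathcomp Require Import mxrepresentation.

Set Implicit Arguments.
Unset Strict Implicit.
Unset Printing Implicit Defensive.

Import GroupScope GRing.Theory.

(* The last clause is the universal property of the presentation with
   generators S and relations (s t)^m(s,t) = 1, where m(s,t) is the order of
   s t in W; for s = t it reads s^2 = 1.  The target G ranges over all groups,
   finite or not.  Uniqueness of phi on W follows from the first clause. *)
Definition coxeter_system (gT : finGroupType) (W : {group gT}) (S : {set gT}) :
    Prop :=
  [/\ <<S>> = W,
      (forall s, s \in S -> #[s] = 2)
    & forall (G : groupType) (f : gT -> G),
        {in S &, forall s t, (f s * f t) ^+ #[s * t] = 1} ->
        exists2 phi : gT -> G,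
          {in W &, {morph phi : x y / x * y}} & {in S, phi =1 f}].

Section Length.

Variables (gT : finGroupType) (S : {set gT}).

(* S ^+ k is a power of sets: the set of products of k elements of S. *)
Lemma exists_word (w : gT) : exists k, (w \in <<S>>) ==> (w \in S ^+ k).
Proof.
have [/gen_prodgP[n [c Sc ->]] | _] := boolP (w \in <<S>>); last by exists 0%N.
exists n; elim: n c Sc => [|n IHn] c Sc.
  by rewrite big_ord0 expg0 set11.
by rewrite big_ord_recl expgS mem_mulg ?Sc //; apply: IHn.
Qed.

(* Words use the elements of S and not their inverses: S will consist of
   involutions.  Outside <<S>> the value is 0. *)
Definition length (w : gT) : nat := ex_minn (exists_word w).

(* For K \subset S: the w in <<A>> of minimal S-length in the coset w <<K>>. *)
Definition min_reps (A K : {set gT}) : {set gT} :=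
  [set w in <<A>> | [forall v in w *: <<K>>, length w <= length v]].

End Length.

Local Open Scope ring_scope.

Section DescentAlgebra.

Variables (gT : finGroupType) (S : {set gT}).

(* The group algebra of <<S>> over rat is MathComp's group_ring, that is, the
   span of the matrices of the regular representation; gset_mx rat <<S>> X
   stands for \sum_(w in X) w. *)
Definition descent_elt (K : {set gT}) : 'M[rat]_#|<<S>>| :=
  gset_mx rat <<S>> (min_reps S S K).

Definition descent_algebra : {vspace 'M[rat]_#|<<S>>|} :=
  <<[seq descent_elt K | K in powerset S]>>%VS.

End DescentAlgebra.

Definition is_subalgebra (n : nat) (A : {vspace 'M[rat]_n}) : Prop :=
  1%:M \in A /\ {in A &, forall u v, u *m v \in A}.

Definition is_algebra_morphism (n m : nat) (A : {vspace 'M[rat]_n})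
    (B : {vspace 'M[rat]_m}) (f : 'Hom(subvs_of A, subvs_of B)) : Prop :=
  [/\ is_subalgebra A /\ is_subalgebra B,
      vsval (f (vsproj A 1%:M)) = 1%:M
    & {in A &, forall u v,
        vsval (f (vsproj A (u *m v)))
          = vsval (f (vsproj A u)) *m vsval (f (vsproj A v))}].

Section Restriction.

Variables (gT : finGroupType) (I J : {set gT}).

Definition tilde_gens : {set gT} :=
  [set (w * s * w^-1)%g | w in <<I>>, s in J].

(* The minimal length condition on d is with respect to S, and
   <<K>> :^ d^-1 is d <<K>> d^-1. *)
Definition is_tilde_res (S : {set gT})
    (f : 'Hom(subvs_of (descent_algebra S),
              subvs_of (descent_algebra tilde_gens))) : Prop :=
  forall K : {set gT}, K \subset S ->
    vsval (f (vsproj (descent_algebra S) (descent_elt S K))) =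
      \sum_(d in min_reps S I (I :&: K))
        descent_elt tilde_gens (tilde_gens :&: (<<K>> :^ d^-1)%g).

End Restriction.

(* Main.v *)
Require Import Defs.
From HB Require Import structures.
From mathcomp Require Import all_boot all_fingroup all_algebra.
From mathcomp Require Import mxrepresentation.

Set Implicit Arguments.
Unset Strict Implicit.
Unset Printing Implicit Defensive.

Import GroupScope.

(** Geometrically, the descent algebra of [W] is anti-isomorphic to the algebra
    of [W]-invariants of the face semigroup of the reflection arrangement: the
    sum of [min_reps S S K] is what the sum of all faces [w <<K>>] becomes when
    each face acts on the fundamental chamber. The set [tilde_gens I J]
    generates the reflection group of the subarrangement of the hyperplanes
    whose reflections are conjugate to elements of [J]. Restricting faces to a
    subarrangement is a morphism of semigroups, and it commutes with the group;
    that is why the restriction map is a morphism of algebras.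

    The proof runs this argument on inversion sets. To [w] one attaches the set
    [N w] of the reflections whose hyperplane separates [w] from [1]. The
    existence of [N], with [N s = [set s]] and the cocycle rule for products, is
    what the Coxeter presentation is used for (coxeter_cocycle); everything else
    is deduced from these two rules, so it applies verbatim to any pair
    [(S', T')] for which [N w :&: T'] is again a cocycle with generators [S'].
    For [S' = tilde_gens I J] and [T'] the set of conjugates of [J] this holds
    because elements of [<<I>>] have no inversion in [T'] (tilde_cocycle). Since
    [W] is the product of [<<S'>>] and [<<I>>], restricting a chamber to the
    subarrangement sends [w = c * a] to [c]; call this [p w].

    Two computations finish the proof. First, for any such restriction [p], the
    product of the [p]-images of two basis elements of the descent algebra
    expands into [p]-images of basis elements, over an index set that does not
    depend on [p] (sum_proj_mul). With [p] the identity this is Solomon's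
    theorem, so [x |-> p x] is multiplicative on the descent algebra. Second,
    the image under [p] of the basis element of [K] is the sum over [d] that
    defines the restriction map (sum_tilde_proj). The map is thus the
    restriction of a linear map of group algebras, which is why prescribing it
    on the spanning elements is consistent. *)

(** * Inversion cocycles and the exchange property *)

(** [N w] is the set of the inversions of [w]: the reflections [t] such that
    [t * w] is shorter than [w]. The last clause says that [N (x * y)] is the
    symmetric difference of [N x] and [x (N y) x^-1]. *)
Definition reflection_cocycle (gT : finGroupType) (S : {set gT})
    (N : gT -> {set gT}) : Prop :=
  [/\ {in S, forall s, s * s = 1},
      {in S, forall s, N s = [set s]}
    & {in <<S>> &, forall x y t,
         (t \in N (x * y)) = (t \in N x) (+) (t ^ x \in N y)}].

Section Cocycle.

Variables (gT : finGroupType) (S : {set gT}) (N : gT -> {set gT}).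
Hypothesis hN : reflection_cocycle S N.

Lemma cocycle_gen s t : s \in S -> (t \in N s) = (t == s).
Proof. by case: hN => _ h _ Ss; rewrite h // inE. Qed.

Lemma cocycleM x y t : x \in <<S>> -> y \in <<S>> ->
  (t \in N (x * y)) = (t \in N x) (+) (t ^ x \in N y).
Proof. by case: hN => _ _ h Gx Gy; apply: h. Qed.

Lemma cocycle1 t : (t \in N 1) = false.
Proof.
have:= cocycleM t (group1 <<S>>) (group1 <<S>>).
by rewrite mulg1 conjg1; case: (t \in N 1).
Qed.

Lemma cocycleV x t : x \in <<S>> -> (t \in N x^-1) = (t ^ x^-1 \in N x).
Proof.
move=> Gx; have Gx' := groupVr Gx.
have:= cocycleM t Gx' Gx; rewrite mulVg cocycle1.
by case: (t \in N x^-1); case: (_ \in N x).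
Qed.

Lemma cocycle_subsystem (K : {set gT}) :
  K \subset S -> reflection_cocycle K N.
Proof.
move=> sKS; have sGG := subsetP (genS sKS); case: hN => h1 h2 h3.
split=> [s Ks | s Ks | x y Gx Gy t].
- exact/h1/(subsetP sKS).
- exact/h2/(subsetP sKS).
by apply: h3; apply: sGG.
Qed.

Lemma word_gen k w : w \in S ^+ k -> w \in <<S>>.
Proof.
elim: k w => [|k IHk] w; first by rewrite expg0 inE => /eqP->.
by rewrite expgS => /mulsgP[s v Ss /IHk Gv ->]; rewrite groupM // mem_gen.
Qed.

(** Strong exchange: by the cocycle rule, an inversion of [s_1 ... s_k] is one
    of the reflections [s_1 ... s_i ... s_1], and multiplying by it deletes the
    letter [s_i]. *)
Lemma word_exchange k w t :
  w \in S ^+ k -> t \in N w -> exists2 j, (j < k)%N & t * w \in S ^+ j.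
Proof.
elim: k w t => [|k IHk] w t.
  by rewrite expg0 inE => /eqP->; rewrite cocycle1.
rewrite expgS => /mulsgP[s v Ss Sv ->{w}].
have Gs := mem_gen Ss; have Gv := word_gen Sv.
rewrite cocycleM // cocycle_gen //; have [-> _ | _ /=] := eqVneq t s.
  by exists k => //; case: hN => ss _ _; rewrite mulgA ss // mul1g.
case/(IHk _ _ Sv)=> j ltjk Sj; exists j.+1 => //.
by rewrite expgS mulgA (conjgC t s) -mulgA mem_mulg.
Qed.

Lemma length_word w : w \in <<S>> -> w \in S ^+ length S w.
Proof. by rewrite /length; case: ex_minnP => k /implyP. Qed.

Lemma length_min k w : w \in S ^+ k -> (length S w <= k)%N.
Proof.
by rewrite /length; case: ex_minnP => m _ + Sk; apply; apply/implyP.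
Qed.

Lemma length_exchange w t :
  w \in <<S>> -> t \in N w -> (length S (t * w) < length S w)%N.
Proof.
move=> Gw /(word_exchange (length_word Gw))[j ltj /length_min lej].
exact: leq_ltn_trans lej ltj.
Qed.

Lemma cocycle_sub w : w \in <<S>> -> N w \subset <<S>>.
Proof.
move=> Gw; apply/subsetP=> t /(word_exchange (length_word Gw))[j _ /word_gen].
by rewrite groupMr.
Qed.

(** The first letter of a reduced word is an inversion: otherwise it would be an
    inversion of the rest of the word, and exchange would shorten [w]. *)
Lemma left_descent w : w \in <<S>> -> w != 1 -> exists2 s, s \in S & s \in N w.
Proof.
move=> Gw w1; have := length_word Gw.
case Dk: (length S w) => [|k]; first by rewrite expg0 inE (negPf w1).
rewrite expgS => /mulsgP[s v Ss Sv Dw]; exists s => //.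
have Gs := mem_gen Ss; have Gv := word_gen Sv.
rewrite Dw cocycleM // cocycle_gen // eqxx conjgE mulKg addTb.
apply/negP=> /(length_exchange Gv); rewrite -Dw Dk ltnNge.
by rewrite ltnW // ltnS length_min.
Qed.

Lemma cocycle_inj x y :
  x \in <<S>> -> y \in <<S>> -> N x =i N y -> x = y.
Proof.
move=> Gx Gy eqN; apply/eqP; rewrite eq_mulVg1; apply: contraT => ne1.
have Gx' := groupVr Gx.
have [|s _] := left_descent _ ne1; first by rewrite groupM.
by rewrite cocycleM // cocycleV // eqN addbb.
Qed.

(** Peel left descents off [w]: each lies in [S :&: H], and removing it
    conjugates the rest of the cocycle by an element of [H]. *)
Lemma cocycle_sub_parabolic (H : {group gT}) w :
  w \in <<S>> -> N w \subset H -> w \in <<S :&: H>>.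
Proof.
have [n] := ubnP (length S w); elim: n w => // n IHn w /ltnSE lew Gw sNH.
have [-> // | w1] := eqVneq w 1.
have [s Ss Ns] := left_descent Gw w1.
have Gs := mem_gen Ss; have Hs := subsetP sNH s Ns.
rewrite -(groupMl _ (mem_gen _ : s \in <<S :&: H>>)) ?inE ?Ss //.
apply: IHn; first exact: leq_trans (length_exchange Gw Ns) lew.
  by rewrite groupM.
apply/subsetP=> t; rewrite cocycleM // cocycle_gen //.
have [-> // | _ /=] := eqVneq t s.
by move/(subsetP sNH); rewrite groupJr.
Qed.

End Cocycle.

(** * Shortest coset representatives *)

Definition coset_min (gT : finGroupType) (S K : {set gT}) (w : gT) : gT :=
  [arg min_(v < w in w *: <<K>>) length S v].

Section Parabolic.

Variables (gT : finGroupType) (S : {set gT}) (N : gT -> {set gT}).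
Hypothesis hN : reflection_cocycle S N.
Variable K : {set gT}.
Hypothesis sKS : K \subset S.

Let sKG : <<K>> \subset <<S>> := genS sKS.
Let hK : reflection_cocycle K N := cocycle_subsystem hN sKS.

(** [N] is also a cocycle for the generators [K], so inversions computed inside
    the parabolic subgroup [<<K>>] agree with those computed in [<<S>>]. *)
Lemma cocycle_parabolic w : w \in <<K>> -> N w \subset <<K>>.
Proof. exact: cocycle_sub. Qed.

Lemma parabolic_gens : S :&: <<K>> = K.
Proof.
apply/setP=> s; rewrite inE; apply/andP/idP=> [[Ss Ks] | Ks]; last first.
  by rewrite (subsetP sKS) // mem_gen.
have s1: s != 1.
  apply/eqP=> s1; have := cocycle_gen hN s Ss.
  by rewrite eqxx {2}s1 (cocycle1 hN).
have [k Kk] := left_descent hK Ks s1.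
by rewrite (cocycle_gen hN) // => /eqP <-.
Qed.

Lemma coset_min_in w : coset_min S K w \in w *: <<K>>.
Proof. by rewrite /coset_min; case: arg_minnP; rewrite ?lcoset_refl. Qed.

Lemma coset_min_le w v : v \in w *: <<K>> ->
  (length S (coset_min S K w) <= length S v)%N.
Proof.
by rewrite /coset_min; case: arg_minnP => [|x _]; [rewrite lcoset_refl | apply].
Qed.

Lemma coset_minE w : exists2 u, u \in <<K>> & coset_min S K w = w * u.
Proof. by have /lcosetP[u] := coset_min_in w; exists u. Qed.

Lemma coset_min_gen (A : {set gT}) w :
  K \subset A -> w \in <<A>> -> coset_min S K w \in <<A>>.
Proof.
move=> sKA Aw; have [u Ku ->] := coset_minE w.
by rewrite groupM // (subsetP (genS sKA)).
Qed.

(** If [t] is an inversion of [x] and [t ^ x] is in [<<K>>], then [t * x] is a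
    shorter element of [x *: <<K>>]. *)
Lemma min_cocycle x t :
  x \in <<S>> -> {in x *: <<K>>, forall v, length S x <= length S v}%N ->
  t \in N x -> t ^ x \notin <<K>>.
Proof.
move=> Gx minx Nt; apply/negP=> Kt.
have := length_exchange hN Gx Nt; rewrite ltnNge conjgC minx //.
by rewrite mem_lcoset mulKg.
Qed.

(** The condition on inversions determines the representative of a coset: a left
    descent [k] of [u] in [K] would make [k ^ x^-1] an inversion of [x] or of
    [x * u]. *)
Lemma min_cocycle_uniq x u :
  x \in <<S>> -> u \in <<K>> ->
  {in N x, forall t, t ^ x \notin <<K>>} ->
  {in N (x * u), forall t, t ^ (x * u) \notin <<K>>} -> u = 1.
Proof.
move=> Gx Ku minx minxu; apply/eqP; apply: contraT => u1.
have [k Kk Nk] := left_descent hK Ku u1.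
have Gu := subsetP sKG u Ku.
have Kk' := mem_gen Kk.
have nNx: k ^ x^-1 \notin N x.
  by apply/negP=> /minx; rewrite conjgKV Kk'.
have := minxu (k ^ x^-1).
rewrite (cocycleM hN) // (negPf nNx) conjgKV Nk conjgM conjgKV groupJ //.
by move/(_ isT).
Qed.

Lemma coset_min_mem x t : x \in <<S>> ->
  t \in N (coset_min S K x) -> t ^ coset_min S K x \notin <<K>>.
Proof.
move=> Gx; apply: min_cocycle => [|v]; first exact: coset_min_gen.
by rewrite (lcoset_eqP (coset_min_in x)) => /coset_min_le.
Qed.

Lemma coset_min_eq x u :
  x \in <<S>> -> u \in <<K>> -> {in N x, forall t, t ^ x \notin <<K>>} ->
  coset_min S K (x * u) = x.
Proof.
move=> Gx Ku minx; have Gu := subsetP sKG u Ku.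
have := @coset_min_mem (x * u) ^~ (groupM Gx Gu).
have [v Kv ->] := coset_minE (x * u); rewrite -mulgA => min'.
by rewrite (min_cocycle_uniq Gx _ minx min') ?mulg1 ?groupM.
Qed.

(** This replaces the minimal length condition by one on the separating
    hyperplanes: a shortest representative satisfies it by min_cocycle, and only
    one element of the coset does. [A] and [S] differ in the case of the
    representatives of [<<I>> / <<I :&: K>>], whose length is counted in [S]. *)
Lemma min_repsP (A : {set gT}) x : K \subset A -> A \subset S ->
  reflect (x \in <<A>> /\ {in N x, forall t, t ^ x \notin <<K>>})
          (x \in min_reps S A K).
Proof.
move=> sKA sAS; rewrite inE; apply: (iffP andP) => -[Ax minx]; split=> //.
  move=> t; apply: min_cocycle; first exact: (subsetP (genS sAS)).
  by move=> v xv; have /forallP/(_ v)/implyP := minx; apply.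
apply/forallP=> v; apply/implyP=> /lcosetP[u Ku ->].
have Gx: x \in <<S>> by apply: (subsetP (genS sAS)).
rewrite -{1}(coset_min_eq Gx Ku minx) coset_min_le //.
by rewrite lcoset_refl.
Qed.

(** The hyperplanes that contain the face [w <<K>>] are those of the reflections
    of [w <<K>> w^-1]; the chamber of this face nearest to [1] lies on the same
    side as [w] of the other hyperplanes, and on the side of [1] of these. *)
Lemma cocycle_coset_min w t : w \in <<S>> ->
  (t \in N (coset_min S K w)) = (t \in N w) && (t ^ w \notin <<K>>).
Proof.
move=> Gw; have := @coset_min_mem w t Gw.
have [u Ku Dx] := coset_minE w; rewrite Dx => Nt.
have Gu := subsetP sKG u Ku; move: Nt.
rewrite (cocycleM hN) // conjgM groupJr //.
have [Kt | nKt] /= := boolP (t ^ w \in <<K>>).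
  by rewrite andbF; case: (_ (+) _) => // /(_ isT).
rewrite andbT => _.
by rewrite (contraNF (subsetP (cocycle_parabolic Ku) _) nKt) addbF.
Qed.

End Parabolic.

(** * Intersections of parabolic subgroups *)

Section SubsystemMeet.

Variables (gT : finGroupType) (S : {set gT}) (N : gT -> {set gT}).
Hypothesis hN : reflection_cocycle S N.

(** If [t] in [T'] is an inversion of [w = d r d^-1], with [w] in [<<S'>>] and
    [r] in [<<L>>], the cocycle rule leaves [t ^ d \in N r] as the only
    possibility, because neither [t] nor [t ^ w] is an inversion of [d]. Hence
    all inversions of [w] in [T'] lie in [<<L>> :^ d^-1], and
    cocycle_sub_parabolic applies. With [S' = K] and [T' = <<K>>] this is
    Kilmoyer's theorem on the intersection of two parabolic subgroups. *)
Lemma parabolic_meet (S' T' L : {set gT}) d :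
  S' \subset <<S>> -> reflection_cocycle S' (fun w => N w :&: T') ->
  <<S'>> \subset 'N(T') -> L \subset S -> d \in <<S>> -> [disjoint N d & T'] ->
  <<S' :&: <<L>> :^ d^-1>> = <<S'>> :&: <<L>> :^ d^-1.
Proof.
move=> sS'G hN' nT' sLS Gd dNT.
have sG'G: <<S'>> \subset <<S>> by rewrite gen_subG.
have Gd' := groupVr Gd.
apply/eqP; rewrite eqEsubset; apply/andP; split.
  rewrite gen_subG subsetI (subset_trans (subsetIl _ _)) ?subset_gen //.
  exact: subsetIr.
apply/subsetP=> w /setIP[G'w]; rewrite mem_conjgV => Lw.
apply: (cocycle_sub_parabolic hN' (H := (<<L>> :^ d^-1)%G)) => //.
apply/subsetP=> t /setIP[Nt T't]; rewrite mem_conjgV.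
have nd u : u \in T' -> (u \in N d) = false.
  by move=> T'u; rewrite (disjointFl dNT).
have Dw: w = d * (w ^ d * d^-1) by rewrite mulgA -conjgC mulgK.
have Gw := subsetP sG'G w G'w; have Gwd : w ^ d \in <<S>> by rewrite groupJ.
have T'tw : t ^ w \in T' by rewrite memJ_norm // (subsetP nT').
have Gwd' := groupM Gwd Gd'.
move: Nt; rewrite Dw (cocycleM hN) // nd //= (cocycleM hN) //.
rewrite (cocycleV hN) // -!conjgM mulgA -conjgC mulgK nd // addbF.
exact/subsetP/(cocycle_parabolic hN sLS).
Qed.

End SubsystemMeet.

(** * Products of faces and Solomon's rule *)

(** The product, in the face semigroup, of the face [y <<K>>] and the chamber
    [x]: the chamber of that face which is nearest to [x]. *)
Definition face_move (gT : finGroupType) (S K : {set gT}) (y x : gT) : gT :=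
  x * coset_min S K (x^-1 * y).

(** The shortest elements of the double cosets [<<K>> d <<L>>]: that [d] is
    shortest in [<<K>> d] is expressed by its inversions. *)
Definition double_min_reps (gT : finGroupType) (S : {set gT})
    (N : gT -> {set gT}) (K L : {set gT}) : {set gT} :=
  [set d in min_reps S S L | [disjoint N d & <<K>>]].

Section FaceProduct.

Variables (gT : finGroupType) (S : {set gT}) (N : gT -> {set gT}).
Hypothesis hN : reflection_cocycle S N.

(** The rule for multiplying sign vectors: the sign of [x] is used exactly on
    the hyperplanes that contain the face [y <<K>>]. *)
Lemma cocycle_face_move (K : {set gT}) x y t :
  K \subset S -> x \in <<S>> -> y \in <<S>> ->
  (t \in N (face_move S K y x))
    = if t ^ y \in <<K>> then t \in N x else t \in N y.
Proof.
move=> sKS Gx Gy; have Gx' := groupVr Gx.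
have Gm : coset_min S K (x^-1 * y) \in <<S>> by rewrite coset_min_gen ?groupM.
rewrite (cocycleM hN) // (cocycle_coset_min hN) ?(groupM Gx') //.
rewrite (cocycleM hN) // (cocycleV hN) // -!conjgM mulKVg mulgV conjg1.
by case: (t \in N x); case: (t \in N y); case: (t ^ y \in _).
Qed.

Lemma face_move_gen (K : {set gT}) x y :
  K \subset S -> x \in <<S>> -> y \in <<S>> -> face_move S K y x \in <<S>>.
Proof. by move=> sKS Gx Gy; rewrite groupM ?coset_min_gen ?groupM ?groupV. Qed.

Lemma face_moveE (K : {set gT}) x y :
  exists2 u, u \in <<K>> & face_move S K y x = y * u.
Proof.
have [u Ku Dm] := coset_minE S K (x^-1 * y).
by exists u => //; rewrite /face_move Dm -mulgA mulKVg.
Qed.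

Section DoubleCosets.

Variables K L : {set gT}.
Hypotheses (sKS : K \subset S) (sLS : L \subset S).

Let M d := K :&: <<L>> :^ d^-1.
Let sMS d : M d \subset S. Proof. exact: subset_trans (subsetIl _ _) sKS. Qed.
Let D := double_min_reps S N K L.
Let X := min_reps S S.

Let XP (A : {set gT}) x : A \subset S ->
  reflect (x \in <<S>> /\ {in N x, forall t, t ^ x \notin <<A>>}) (x \in X A).
Proof. by move=> sAS; apply: (min_repsP hN). Qed.

Lemma double_coset_meet d : d \in D -> <<M d>> = <<K>> :&: <<L>> :^ d^-1.
Proof.
case/setIdP=> /(XP _ sLS)[Gd _] dNK.
apply: (parabolic_meet hN _ _ (normG _) sLS Gd dNK).
  by rewrite (subset_trans sKS) ?subset_gen.
have [h1 h2 h3] := cocycle_subsystem hN sKS; split=> // [s Ks | x y Kx Ky t].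
  by rewrite h2 //; apply/setIidPl; rewrite sub1set mem_gen.
by rewrite !inE h3 // groupJr //; case: (t \in <<K>>); rewrite ?andbT ?andbF.
Qed.

(** Faces [x <<L>>] and [y <<K>>] with nearest chambers [x] and [y] are the
    translates by a common [w] of [d <<L>>] and [<<K>>], with [d] a double coset
    representative. Taking [w] to be the product of the second face with [x]
    makes [w] unique, and then [w] is shortest modulo [<<M d>>], the common
    stabilizer of [d <<L>>] and [<<K>>]. This lemma and the next one give the
    two directions of this bijection between pairs [(x, y)] and [(d, w)]. *)
Lemma double_coset_split d w : d \in D -> w \in X (M d) ->
  let x := coset_min S L (w * d) in let y := coset_min S K w in
  [/\ x \in X L, y \in X K, face_move S K y x = w
     & coset_min S L (w^-1 * x) = d].
Proof.
move=> Dd /(XP _ (sMS d))[Gw minw] x y.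
have defM := double_coset_meet Dd; case/setIdP: Dd => /(XP _ sLS)[Gd mind] dNK.
have Gwd := groupM Gw Gd; have Gx : x \in <<S>> by rewrite coset_min_gen.
have Gy : y \in <<S>> by rewrite coset_min_gen.
split; first by apply/XP=> //; split=> // t; apply: coset_min_mem.
- by apply/XP=> //; split=> // t; apply: coset_min_mem.
- apply: (cocycle_inj hN) => // [|t]; first exact: face_move_gen.
  (* An inversion [t] of [w] with [t ^ w] in [<<K>>] survives in [x]: if
     [t ^ (w * d)] were in [<<L>>], then [t ^ w] would be in [<<M d>>]. *)
  rewrite cocycle_face_move //; have [u Ku Dy] := coset_minE S K w.
  rewrite {1}/y Dy conjgM groupJr // !(cocycle_coset_min hN) //.
  case: ifPn => [Kt | ->]; last exact: andbT.
  rewrite (cocycleM hN) // (disjointFl dNK) // addbF.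
  apply/andb_idr=> /minw; rewrite defM inE Kt mem_conjgV conjgM; exact.
have [u Lu Dx] := coset_minE S L (w * d).
by rewrite /x Dx -mulgA mulKg (coset_min_eq hN).
Qed.

Lemma double_coset_join x y : x \in X L -> y \in X K ->
  let w := face_move S K y x in let d := coset_min S L (w^-1 * x) in
  [/\ d \in D, w \in X (M d), coset_min S L (w * d) = x & coset_min S K w = y].
Proof.
case/(XP _ sLS)=> Gx minx /(XP _ sKS)[Gy miny] w d.
have Gw : w \in <<S>> by apply: face_move_gen.
have Gwx : w^-1 * x \in <<S>> by rewrite groupM ?groupV.
have Gd : d \in <<S>> by rewrite coset_min_gen.
have mind : {in N d, forall t, t ^ d \notin <<L>>}.
  by move=> t; apply: coset_min_mem.
have [u Lu Dd] : exists2 u, u \in <<L>> & d = w^-1 * x * u by apply: coset_minE.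
have [k Kk Dw] : exists2 k, k \in <<K>> & w = y * k by apply: face_moveE.
have Nw t := cocycle_face_move t sKS Gx Gy; rewrite -/w in Nw.
clearbody d w.
have Dwd : w * d = x * u by rewrite Dd -mulgA mulKVg.
have defx : coset_min S L (w * d) = x by rewrite Dwd (coset_min_eq hN).
have Kwy t : (t ^ w \in <<K>>) = (t ^ y \in <<K>>) by rewrite Dw conjgM groupJr.
have {}Nw t : t ^ w \in <<K>> -> (t \in N w) = (t \in N x).
  by rewrite Kwy Nw => ->.
have Lwx t : (t ^ (w * d) \in <<L>>) = (t ^ x \in <<L>>).
  by rewrite Dwd conjgM groupJr.
split=> //; last by rewrite Dw (coset_min_eq hN).
  rewrite inE; apply/andP; split; first exact/XP.
  rewrite disjoint_subset; apply/subsetP=> t Nt; rewrite inE; apply/negP=> Kt.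
  (* Compare [w * d] and its shortest representative [x] at the reflection
     [t ^ w^-1], which fixes the face of [w <<K>>] but not that of [x <<L>>]:
     there [x] agrees with [w] and with [w * d], which [t \in N d] excludes. *)
  have nLt := mind t Nt; have tw : (t ^ w^-1) ^ w = t by rewrite conjgKV.
  have := cocycle_coset_min hN sLS (t ^ w^-1) (groupM Gw Gd).
  rewrite defx conjgM tw nLt andbT (cocycleM hN) // tw Nt -Nw ?tw //.
  by case: (_ \in _).
apply/XP=> //; split=> // t Nt; apply/negP=> Mt.
have Kt: t ^ w \in <<K>> by apply: subsetP Mt; rewrite genS ?subsetIl.
move: (Nt); rewrite Nw // => /minx; rewrite -Lwx conjgM -mem_conjgV.
case/negP; apply: subsetP Mt; rewrite gen_subG; exact: subsetIr.
Qed.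

Lemma sum_face_move (V : nmodType) (F : gT -> V) :
  (\sum_(x in X L) \sum_(y in X K) F (face_move S K y x)
    = \sum_(d in D) \sum_(w in X (M d)) F w)%R.
Proof.
rewrite !pair_big_dep /=.
pose h (p : gT * gT) := (coset_min S L (p.2 * p.1), coset_min S K p.2).
pose h' (p : gT * gT) :=
  let w := face_move S K p.2 p.1 in (coset_min S L (w^-1 * p.1), w).
rewrite (reindex_onto h h') => [|[x y] /= /andP[Xx Xy]]; last first.
  by have [_ _ Dx Dy] := double_coset_join Xx Xy; rewrite /h /= Dx Dy.
apply: eq_big => [[d w]|[d w] /andP[_ /eqP[_ ->]] //] /=.
apply/idP/idP=> [/andP[/andP[Xx Xy] /eqP[Dd Dw]] | /andP[Dd Xw]].
  by have [] := double_coset_join Xx Xy; rewrite Dd Dw => -> ->.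
by have [-> -> Dw Dd'] := double_coset_split Dd Xw; rewrite /h' /= Dw Dd' /=.
Qed.

End DoubleCosets.

(** Left translation by [g] permutes the faces of type [K]. *)
Lemma sum_coset_translate (K : {set gT}) g (V : nmodType) (F : gT -> V) :
  K \subset S -> g \in <<S>> ->
  (\sum_(y in min_reps S S K) F y
     = \sum_(y in min_reps S S K) F (coset_min S K (g * y)%g))%R.
Proof.
move=> sKS Gg.
have Xm a y : a \in <<S>> -> y \in min_reps S S K ->
    coset_min S K (a * y) \in min_reps S S K
    /\ coset_min S K (a^-1 * coset_min S K (a * y)) = y.
  move=> Ga /(min_repsP hN sKS _ sKS (subxx S))[Gy miny].
  have Gay := groupM Ga Gy.
  have [u Ku Dm] := coset_minE S K (a * y); split.
    apply/(min_repsP hN) => //; split; first exact: coset_min_gen.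
    by move=> t; apply: coset_min_mem.
  by rewrite Dm -mulgA mulKg (coset_min_eq hN).
rewrite (reindex_onto (fun y => coset_min S K (g * y))
                      (fun y => coset_min S K (g^-1 * y))) /=; last first.
  by move=> y /(Xm _ _ (groupVr Gg))[_]; rewrite invgK.
apply: eq_bigl => y; apply/andP/idP=> [[Xgy /eqP <-] | /(Xm _ _ Gg)[-> ->] //].
by have [] := Xm _ _ (groupVr Gg) Xgy.
Qed.

End FaceProduct.

(** * Restriction to a subarrangement *)

(** [p x] is the element of [<<S'>>] whose chamber, in the arrangement of the
    reflections in [T'], contains the chamber of [x]. *)
Definition cocycle_projection (gT : finGroupType) (S : {set gT})
    (N : gT -> {set gT}) (S' T' : {set gT}) (p : gT -> gT) : Prop :=
  [/\ S' \subset <<S>>, <<S>> \subset 'N(T'),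
      reflection_cocycle S' (fun w => N w :&: T')
    & {in <<S>>, forall x, p x \in <<S'>> /\ N (p x) :&: T' = N x :&: T'}].

Section Projection.

Variables (gT : finGroupType) (S : {set gT}) (N : gT -> {set gT}).
Variables (S' T' : {set gT}) (p : gT -> gT).
Hypotheses (hN : reflection_cocycle S N) (hp : cocycle_projection S N S' T' p).

Lemma proj_gen x : x \in <<S>> -> p x \in <<S'>>.
Proof. by case: hp => _ _ _ h /h[]. Qed.

Lemma proj_cocycle x t :
  x \in <<S>> -> t \in T' -> (t \in N (p x)) = (t \in N x).
Proof.
case: hp => _ _ _ h /h[_ /setP/(_ t)].
by rewrite !inE => + T't; rewrite T't !andbT.
Qed.

Lemma sub_gen x : x \in <<S'>> -> x \in <<S>>.
Proof. by case: hp => sS' _ _ _; apply/subsetP; rewrite gen_subG. Qed.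

Lemma projE x c : x \in <<S>> -> c \in <<S'>> -> {in T', N x =i N c} -> p x = c.
Proof.
move=> Gx G'c eqN; case: hp => _ _ h' _.
apply: (cocycle_inj h') => // [|t]; first exact: proj_gen.
rewrite !inE; have [T't | _] := boolP (t \in T'); last by rewrite !andbF.
by rewrite proj_cocycle // eqN.
Qed.

Lemma proj_eq x y :
  x \in <<S>> -> y \in <<S>> -> {in T', N x =i N y} -> p x = p y.
Proof.
move=> Gx Gy eqN; apply: projE => // [|t T't]; first exact: proj_gen.
by rewrite proj_cocycle // eqN.
Qed.

Lemma proj_id c : c \in <<S'>> -> p c = c.
Proof. by move=> G'c; apply: projE => //; apply: sub_gen. Qed.

Lemma projM c x : c \in <<S'>> -> x \in <<S>> -> p (c * x) = c * p x.
Proof.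
move=> G'c Gx; have Gc := sub_gen G'c; have G'x := proj_gen Gx.
apply: projE; rewrite ?groupM // => t T't.
rewrite !(cocycleM hN) ?proj_cocycle //; last exact: sub_gen.
by case: hp => _ nT' _ _; rewrite memJ_norm // (subsetP nT').
Qed.

(** For fixed [x], translating the faces of type [K] by [p x] turns [p x * p y]
    into [p] of the product of a face with [p x]; restricted to [T'], that
    product depends on [p x] only through its signs on [T'], so [x] may replace
    [p x]. What remains is a sum of [F \o p] over products of faces with
    chambers of [<<S>>], to which sum_face_move applies. *)
Lemma sum_proj_mul (K L : {set gT}) (V : nmodType) (F : gT -> V) :
  K \subset S -> L \subset S ->
  (\sum_(x in min_reps S S L) \sum_(y in min_reps S S K) F (p x * p y)%g
    = \sum_(d in double_min_reps S N K L)
        \sum_(w in min_reps S S (K :&: <<L>> :^ d^-1)%g) F (p w))%R.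
Proof.
move=> sKS sLS; rewrite -(sum_face_move hN sKS sLS (F \o p)).
apply: eq_bigr => x /(min_repsP hN sLS _ sLS (subxx S))[Gx _].
have G'x := proj_gen Gx; have Gpx := sub_gen G'x.
rewrite (sum_coset_translate hN _ sKS (groupVr Gpx)).
apply: eq_bigr => y /(min_repsP hN sKS _ sKS (subxx S))[Gy _] /=.
rewrite -projM //; last by rewrite coset_min_gen ?groupM ?groupV.
congr F; apply: proj_eq; rewrite ?(face_move_gen sKS) // => t T't.
by rewrite !(cocycle_face_move hN) // proj_cocycle.
Qed.

End Projection.

(** * The inversion cocycle of a Coxeter system *)

Section SignedConjugation.

Variable gT : finGroupType.

(** The action of a generator on signed reflections: conjugation, with a change
    of sign at [s]. The signs accumulated along a word record, modulo two, how
    often each reflection is crossed. On [gT * bool] it is a bijection for every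
    [s], involution or not. *)
Definition signed_conj (s : gT) (a : gT * bool) : gT * bool :=
  (a.1 ^ s, a.2 (+) (a.1 == s)).

Lemma signed_conj_inj s : injective (signed_conj s).
Proof. by case=> [t a] [u b] [/conjg_inj <- /addIb->]. Qed.

Definition signed_perm s : {perm gT * bool} := perm (@signed_conj_inj s).

(** Along the word [s t s t ...] with [2 k] letters, the sign at [u] changes at
    each [j < 2 k] for which [u = (s t)^j s]. *)
Lemma signed_permX s t k u e : s * s = 1 -> t * t = 1 ->
  ((signed_perm s * signed_perm t) ^+ k) (u, e)
    = (u ^ (s * t) ^+ k, e (+) odd (\sum_(j < k.*2) (u == (s * t) ^+ j * s)%g)).
Proof.
move=> ss tt; set r := s * t.
have Vs : s^-1 = s by apply/eqP; rewrite eq_invg_mul ss.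
have Vt : t^-1 = t by apply/eqP; rewrite eq_invg_mul tt.
have rs j : s * r ^- j = r ^+ j * s.
  rewrite [RHS]conjgC conjXg -expVgn; congr (_ * _ ^+ _).
  by rewrite /r invMg Vs Vt conjgE Vs !mulgA ss mul1g.
elim: k => [|k IHk]; first by rewrite !expg0 perm1 conjg1 big_ord0 addbF.
rewrite expgSr !permM IHk !permE /signed_conj /= doubleS !big_ord_recr /=.
rewrite expgSr !conjgM; congr (_, _); rewrite -/r !oddD !addbA.
set b := e (+) odd _.
have -> : (u ^ r ^+ k == s) = (u == r ^+ k.*2 * s).
  rewrite (can2_eq (conjgK _) (conjgKV _)); congr (_ == _).
  by rewrite conjgE invgK rs mulgA -expgD addnn.
have -> : ((u ^ r ^+ k) ^ s == t) = (u == r ^+ k.*2.+1 * s).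
  rewrite -conjgM (can2_eq (conjgK _) (conjgKV _)); congr (_ == _).
  rewrite invMg Vs conjgM [t ^ s]conjgE Vs (mulgA s) -/r conjgE invgK -mulgA rs.
  by rewrite mulgA -expgSr mulgA -expgD addSn addnn.
by rewrite !oddb.
Qed.

(** If [m] is the order of [s t], then [j] and [j + m] give the same reflection
    [(s t)^j s], so every sign is changed an even number of times. *)
Lemma signed_perm_braid s t : s * s = 1 -> t * t = 1 ->
  (signed_perm s * signed_perm t) ^+ #[s * t] = 1.
Proof.
move=> ss tt; apply/permP=> -[u e]; rewrite signed_permX // perm1.
rewrite expg_order conjg1 -addnn big_split_ord /=.
under [X in (_ + X)%N]eq_bigr do rewrite expgD expg_order mul1g.
by rewrite addnn odd_double addbF.
Qed.

End SignedConjugation.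

(** By the universal property the signed conjugations extend to [W]; the signs
    they produce form the cocycle. *)
Lemma coxeter_cocycle (gT : finGroupType) (W : {group gT}) (S : {set gT}) :
  coxeter_system W S -> exists N, reflection_cocycle S N.
Proof.
case=> genS ordS univ.
have ss : {in S, forall s, s * s = 1}.
  by move=> s /ordS o2; rewrite -expg2 -o2 expg_order.
have [|phi phiM phiS] := univ _ (@signed_perm gT).
  by move=> s t /ss s1 /ss t1; apply: signed_perm_braid.
pose N w := [set t | (phi w (t, false)).2].
have phi1 : phi 1 = 1.
  by apply: (mulgI (phi 1)); rewrite -phiM ?group1 ?mulg1.
have phiE w : w \in W -> forall t e, phi w (t, e) = (t ^ w, e (+) (t \in N w)).
  rewrite -genS => /gen_prodgP[n [c Sc ->]].
  elim: n c Sc => [|n IHn] c Sc t e.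
    by rewrite big_ord0 inE phi1 !perm1 conjg1 addbF.
  have Wc i : c i \in W by rewrite -genS mem_gen.
  rewrite big_ord_recl inE phiM ?group_prod //.
  rewrite !permM (phiS (c ord0)) // !permE /signed_conj /= !IHn //.
  rewrite conjgM /= addbA.
  by rewrite !inE.
exists N; split=> // [s Ss | x y Wx Wy t].
  by apply/setP=> t; rewrite !inE phiS // permE /=.
by rewrite genS in Wx Wy; rewrite inE phiM // permM phiE //= phiE.
Qed.

(** * The subarrangement of the reflections conjugate to [J] *)

Section Tilde.

Variables (gT : finGroupType) (S I J : {set gT}) (N : gT -> {set gT}).
Hypotheses (hN : reflection_cocycle S N) (hS : S = I :|: J).
Hypothesis hconj : forall s t, s \in I -> t \in J -> t \notin s ^: <<S>>.

Let sIS : I \subset S. Proof. by rewrite hS subsetUl. Qed.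
Let sJS : J \subset S. Proof. by rewrite hS subsetUr. Qed.
Let sIG := genS sIS.
Let T' := class_support J <<S>>.
Let J' := tilde_gens I J.

Let nT' : <<S>> \subset 'N(T'). Proof. exact: class_support_norm. Qed.

(** The inversions of [a] are conjugate to elements of [I], and these are not
    conjugate to elements of [J]. *)
Lemma cocycle_disjoint_conj a : a \in <<I>> -> [disjoint N a & T'].
Proof.
case/gen_prodgP=> n [c Ic ->]; elim: n c Ic => [|n IHn] c Ic.
  rewrite big_ord0 disjoint_subset; apply/subsetP=> t.
  by rewrite (cocycle1 hN).
have Gc i : c i \in <<S>> by rewrite (subsetP sIG) ?mem_gen.
rewrite big_ord_recl disjoint_subset; apply/subsetP=> t.
rewrite inE (cocycleM hN) ?group_prod // (cocycle_gen hN) ?(subsetP sIS) //.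
apply: contraL => T't.
rewrite (disjointFl (IHn _ _)) ?memJ_norm ?(subsetP nT') // addbF.
apply: contraTneq T't => ->; apply/imset2P=> -[j x Jj Gx Dc].
have := hconj (Ic ord0) Jj; rewrite Dc class_sym.
by rewrite memJ_class.
Qed.

(** The other terms of the cocycle rule for [w * s * w^-1] are inversions of
    [w], hence outside [T']. *)
Lemma cocycle_tilde_gen w s t : w \in <<I>> -> s \in J -> t \in T' ->
  (t \in N (w * s * w^-1)) = (t == w * s * w^-1).
Proof.
move=> Iw Js T't; have Gw := subsetP sIG w Iw.
have Gs := mem_gen (subsetP sJS s Js).
have dN u (T'u : u \in T') := disjointFl (cocycle_disjoint_conj Iw) T'u.
have Gws := groupM Gw Gs; have Gw' := groupVr Gw.
rewrite (cocycleM hN) // (cocycleV hN) // (cocycleM hN) //.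
rewrite [_ \in N s](cocycle_gen hN) ?(subsetP sJS) // !dN ?addbF //=;
  last by rewrite !memJ_norm ?(subsetP nT').
by rewrite (can2_eq (conjgK _) (conjgKV _)) conjgE invgK mulgA.
Qed.

Lemma tilde_gensP t :
  reflect (exists2 w, w \in <<I>> & exists2 s, s \in J & t = w * s * w^-1)
          (t \in J').
Proof.
apply: (iffP imset2P) => [[w s Iw Js ->] | [w Iw [s Js ->]]].
  by exists w => //; exists s.
by exists w s.
Qed.

Lemma tilde_gens_sub : J' \subset <<S>>.
Proof.
apply/subsetP=> _ /tilde_gensP[w Iw [s Js ->]].
have Gw := subsetP sIG w Iw; have Gs := mem_gen (subsetP sJS s Js).
by rewrite !groupM ?groupV.
Qed.

(** Intersecting with [T'] keeps the cocycle rule because [T'] is stable under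
    conjugation. It stands for the assertion that [<<J'>>] is a Coxeter group
    with generators [J']. *)
Lemma tilde_cocycle : reflection_cocycle J' (fun w => N w :&: T').
Proof.
split=> [_ /tilde_gensP[w Iw [s Js ->]] | _ /tilde_gensP[w Iw [s Js ->]] | x y].
- case: hN => ss _ _.
  by rewrite !mulgA mulgKV -(mulgA w) ss ?(subsetP sJS) // mulg1 mulgV.
- have Gw := subsetP sIG w Iw.
  apply/setP=> t; rewrite !inE; have [T't | nT't] := boolP (t \in T').
    by rewrite andbT cocycle_tilde_gen.
  rewrite andbF; apply/esym; apply: contraNF nT't => /eqP->.
  rewrite -mulgA -{1}(invgK w) -conjgE.
  by apply: memJ_class_support; rewrite ?groupV.
have sG : <<J'>> \subset <<S>> by rewrite gen_subG tilde_gens_sub.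
move=> /(subsetP sG) Gx /(subsetP sG) Gy t; rewrite !inE (cocycleM hN) //.
rewrite [_ ^ _ \in T']memJ_norm ?(subsetP nT') //.
by case: (t \in T'); rewrite ?andbT ?andbF.
Qed.

(** [<<I>>] permutes [J'] by conjugation, and [I] and [J] generate [<<S>>]. *)
Lemma tilde_decomposition w : w \in <<S>> ->
  exists c a, [/\ c \in <<J'>>, a \in <<I>> & w = c * a].
Proof.
have nJI : <<I>> \subset 'N(<<J'>>).
  apply/subsetP=> a Ia; rewrite inE -genJ; apply: genS.
  apply/subsetP=> _ /imsetP[_ /tilde_gensP[v Iv [s Js ->]] ->].
  apply/tilde_gensP; exists (a^-1 * v); first by rewrite groupM ?groupV.
  by exists s => //; rewrite conjgE invMg invgK !mulgA.
have: <<S>> \subset <<J'>> <*> <<I>>.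
  rewrite gen_subG hS subUset; apply/andP; split; apply/subsetP=> s Ss.
    by rewrite mem_gen // inE (mem_gen Ss) orbT.
  rewrite mem_gen // inE mem_gen //; apply/tilde_gensP; exists 1 => //.
  by exists s; rewrite // mul1g invg1 mulg1.
rewrite norm_joinEr // => /subsetP sG /sG/mulsgP[c a Jc Ia ->].
by exists c, a.
Qed.

(** The factor [c] of [w = c * a], with [c] in [<<J'>>] and [a] in [<<I>>]; it
    is selected by its inversions because [a] has none in [T']. *)
Definition tilde_proj (w : gT) : gT :=
  odflt 1 [pick c in <<J'>> | N c :&: T' == N w :&: T'].

Lemma tilde_projP : cocycle_projection S N J' T' tilde_proj.
Proof.
split; [exact: tilde_gens_sub | exact: nT' | exact: tilde_cocycle |].
move=> w /tilde_decomposition[c [a [Jc Ia Dw]]]; rewrite /tilde_proj.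
case: pickP => /= [x /andP[Jx /eqP]// | /(_ c)].
rewrite Jc Dw => /= /eqP[]; apply/setP=> t; rewrite !inE.
have Gc : c \in <<S>> by apply: subsetP Jc; rewrite gen_subG tilde_gens_sub.
have [T't | _] := boolP (t \in T'); last by rewrite !andbF.
have Ga := subsetP sIG a Ia.
rewrite (cocycleM hN) // (disjointFl (cocycle_disjoint_conj Ia)).
  by rewrite addbF.
by rewrite memJ_norm // (subsetP nT').
Qed.

Lemma tilde_projE c a : c \in <<J'>> -> a \in <<I>> -> tilde_proj (c * a) = c.
Proof.
move=> Jc Ia; have Ga := subsetP sIG a Ia; have hp := tilde_projP.
rewrite (projM hN hp) // (projE hp (c := 1)) ?mulg1 // => t T't.
by rewrite (cocycle1 hN) (disjointFl (cocycle_disjoint_conj Ia)).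
Qed.

Section Formula.

Variable K : {set gT}.
Hypothesis sKS : K \subset S.

Let M d := J' :&: <<K>> :^ d^-1.
Let X := min_reps S S K.
Let XI := min_reps S I (I :&: K).
Let sIKI : I :&: K \subset I := subsetIl I K.
Let sIKS := subset_trans sIKI sIS.
Let sG'G : <<J'>> \subset <<S>>. Proof. by rewrite gen_subG tilde_gens_sub. Qed.

Lemma parabolic_gensI : <<I :&: K>> = <<I>> :&: <<K>>.
Proof.
apply/eqP; rewrite eqEsubset subsetI !genS ?subsetIl ?subsetIr //=.
apply/subsetP=> w /setIP[Iw Kw].
have -> : I :&: K = I :&: <<K>>.
  by rewrite -{1}(parabolic_gens hN sKS) setIA (setIidPl sIS).
apply: (cocycle_sub_parabolic (cocycle_subsystem hN sIS)) => //.
exact: (cocycle_parabolic hN sKS Kw).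
Qed.

Lemma tilde_parabolic_meet d :
  d \in <<I>> -> <<M d>> = <<J'>> :&: <<K>> :^ d^-1.
Proof.
move=> Id; apply: (parabolic_meet hN tilde_gens_sub tilde_cocycle) => //.
- exact: subset_trans sG'G nT'.
- exact: subsetP Id.
exact: cocycle_disjoint_conj.
Qed.

(** Passing to the shortest element of [c * d * <<K>>] removes from the
    inversions of [c] in [T'] those [t] with [t ^ c] in [<<K>> :^ d^-1]. Both
    sides say that there is nothing to remove. *)
Lemma tilde_min_reps c d : c \in <<J'>> -> d \in <<I>> ->
  (c \in min_reps J' J' (M d)) = (tilde_proj (coset_min S K (c * d)) == c).
Proof.
move=> J'c Id; have Gc := subsetP sG'G c J'c; have Gd := subsetP sIG d Id.
have hp := tilde_projP; have Gcd := groupM Gc Gd.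
have Gm : coset_min S K (c * d) \in <<S>> by rewrite coset_min_gen.
have sMJ : M d \subset J' := subsetIl _ _.
have Nm t : t \in T' -> (t \in N (coset_min S K (c * d)))
    = (t \in N c) && (t ^ c \notin <<K>> :^ d^-1).
  move=> T't; have T'tc : t ^ c \in T' by rewrite memJ_norm // (subsetP nT').
  rewrite (cocycle_coset_min hN) // (cocycleM hN) //.
  rewrite (disjointFl (cocycle_disjoint_conj Id) T'tc).
  by rewrite addbF mem_conjgV conjgM.
apply/idP/eqP=> [/(min_repsP tilde_cocycle sMJ _ sMJ (subxx _))[_ minc] | Dc].
  apply: (projE hp) => // t T't; rewrite Nm //; apply/andb_idr=> Nt.
  have NTt : t \in N c :&: T' by rewrite inE Nt.
  have := minc t NTt; rewrite tilde_parabolic_meet // inE.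
  by rewrite groupJr // (subsetP (cocycle_sub tilde_cocycle J'c)).
apply/(min_repsP tilde_cocycle) => //; split=> // t /setIP[Nt T't].
move: (Nt); rewrite -{1}Dc (proj_cocycle hp) // Nm // => /andP[_].
by apply: contra; rewrite tilde_parabolic_meet // => /setIP[].
Qed.

(** The orbits of [<<J'>>] on the faces of type [K] are represented by the faces
    [d <<K>>], with [d] in [XI], and [<<M d>>] is the stabilizer of [d <<K>>] in
    [<<J'>>]. So each face is [c d <<K>>] for a unique [d] and a unique [c] that
    is shortest modulo [<<M d>>], and by tilde_min_reps this [c] is the image of
    the shortest element of the face. *)
Lemma sum_tilde_proj (V : nmodType) (F : gT -> V) :
  (\sum_(x in X) F (tilde_proj x)
    = \sum_(d in XI) \sum_(c in min_reps J' J' (M d)) F c)%R.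
Proof.
rewrite pair_big_dep /=.
pose h (q : gT * gT) := coset_min S K (q.2 * q.1).
pose h' x := (coset_min S (I :&: K) ((tilde_proj x)^-1 * x), tilde_proj x).
have XP x : reflect (x \in <<S>> /\ {in N x, forall t, t ^ x \notin <<K>>})
    (x \in X).
  exact: (min_repsP hN sKS _ sKS (subxx S)).
have XIP d : reflect (d \in <<I>>
    /\ {in N d, forall t, t ^ d \notin <<I :&: K>>}) (d \in XI).
  exact: (min_repsP hN sIKS _ sIKI sIS).
have hK x : x \in X -> h (h' x) = x /\ (h' x).1 \in XI /\
    (h' x).2 \in min_reps J' J' (M (h' x).1).
  case/XP=> Gx minx; have [c [a [J'c Ia Dx]]] := tilde_decomposition Gx.
  have Ga := subsetP sIG a Ia.
  rewrite /h' /h /= Dx tilde_projE // mulKg.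
  have [b IKb Dd] := coset_minE S (I :&: K) a.
  have /setIP[Ib Kb] : b \in <<I>> :&: <<K>> by rewrite -parabolic_gensI.
  have Id : coset_min S (I :&: K) a \in <<I>> by rewrite coset_min_gen.
  have Dm : coset_min S K (c * coset_min S (I :&: K) a) = c * a.
    by rewrite Dd mulgA -Dx (coset_min_eq hN).
  split=> //; split; last by rewrite tilde_min_reps // Dm tilde_projE.
  by apply/XIP; split=> // t; apply: coset_min_mem.
rewrite (reindex_onto h h') => [|x /hK[] //].
apply: eq_big => [[d c]|[d c] /andP[_ /eqP[_ ->]] //] /=.
apply/andP/andP=> [[/hK[_ [Xd Xc]] /eqP[Dd Dc]] | [/XIP[Id mind] Xc]].
  by move: Xd Xc; rewrite /h' /= Dd Dc.
have J'c : c \in <<J'>> by case/setIdP: Xc.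
have Gcd := groupM (subsetP sG'G c J'c) (subsetP sIG d Id).
move: Xc; rewrite tilde_min_reps // => /eqP pc; rewrite /h' /h /= pc.
have Xm : coset_min S K (c * d) \in X.
  by apply/XP; split=> [|t]; [rewrite coset_min_gen | apply: coset_min_mem].
split=> //; apply/eqP; congr (_, _).
have [u Ku Dm] := coset_minE S K (c * d).
have [c1 [a [J'c1 Ia]]] := tilde_decomposition (proj1 (elimT (XP _) Xm)).
rewrite Dm -mulgA mulKg => Dx; move: pc.
rewrite Dm -mulgA Dx tilde_projE // => Dc1.
move: Dx; rewrite {}Dc1 => /mulgI Da.
apply: (coset_min_eq hN) => //; first exact: subsetP Id.
by rewrite parabolic_gensI inE Ku andbT -(groupMl _ Id) Da.
Qed.

End Formula.

End Tilde.

(** * Descent algebras in the group algebra *)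

Import GRing.Theory.
Local Open Scope ring_scope.

Lemma span_ind (F : fieldType) (V : vectType F) (X : seq V) (P : V -> Prop) :
  P 0 -> (forall a u v, P u -> P v -> P (a *: u + v)) ->
  {in X, forall u, P u} -> {in <<X>>%VS, forall u, P u}.
Proof.
move=> P0 Plin PX u; rewrite -[X]/(tval (in_tuple X)) => /coord_span ->.
elim/big_ind: _ => // [x y Px Py | i _].
  by rewrite -[x]scale1r; apply: Plin.
by rewrite -[_ *: _]addr0; apply: Plin => //; apply/PX/mem_nth.
Qed.

Section ProjectionMatrix.

Variables (gT : finGroupType) (S : {set gT}) (N : gT -> {set gT}).
Variables (S' T' : {set gT}) (p : gT -> gT).
Hypotheses (hN : reflection_cocycle S N) (hp : cocycle_projection S N S' T' p).

Local Notation aG := (regular_repr rat <<S>>).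
Local Notation aG' := (regular_repr rat <<S'>>).

(** The linear extension of [p] to group algebras: the coefficient of [x] in an
    element of the group algebra is read in its row indexed by the identity. *)
Definition proj_mx (A : 'M[rat]_#|<<S>>|) : 'M[rat]_#|<<S'>>| :=
  \sum_(x in <<S>>) gring_row A 0 (gring_index <<S>> x) *: aG' (p x).

Lemma proj_mx_is_linear : linear proj_mx.
Proof.
move=> a A B; rewrite /proj_mx scaler_sumr -big_split /=; apply: eq_bigr => x _.
by rewrite linearP !mxE scalerDl scalerA.
Qed.

HB.instance Definition _ :=
  GRing.isLinear.Build rat _ _ _ proj_mx proj_mx_is_linear.

Lemma proj_mx_repr x : x \in <<S>> -> proj_mx (aG x) = aG' (p x).
Proof.
move=> Gx; rewrite /proj_mx (bigD1 x) //= big1 => [|y /andP[Gy ne_yx]];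
  rewrite /gring_row rowK gring_indexK // mul1g mxE eqxx /=.
  by rewrite eqxx scale1r addr0.
by rewrite (can_in_eq (@gring_indexK gT <<S>>)) // (negPf ne_yx) scale0r.
Qed.

Lemma min_reps_sub (A K : {set gT}) x : x \in min_reps S A K -> x \in <<A>>.
Proof. by case/setIdP. Qed.

Lemma proj_mx_descent K :
  proj_mx (descent_elt S K) = \sum_(x in min_reps S S K) aG' (p x).
Proof.
rewrite /descent_elt /gset_mx raddf_sum; apply: eq_bigr => x /min_reps_sub Gx.
exact: proj_mx_repr.
Qed.

Lemma proj_mx_descent_mul (K L : {set gT}) : K \subset S -> L \subset S ->
  proj_mx (descent_elt S L) *m proj_mx (descent_elt S K)
    = \sum_(d in double_min_reps S N K L)
        proj_mx (descent_elt S (K :&: <<L>> :^ d^-1)).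
Proof.
move=> sKS sLS; under eq_bigr do rewrite proj_mx_descent.
rewrite -(sum_proj_mul hN hp aG' sKS sLS) !proj_mx_descent mulmx_suml.
apply: eq_bigr => x /min_reps_sub Gx; rewrite mulmx_sumr.
apply: eq_bigr => y /min_reps_sub Gy.
by rewrite repr_mxM ?(proj_gen hp).
Qed.

End ProjectionMatrix.

Section Solomon.

Variables (gT : finGroupType) (S : {set gT}) (N : gT -> {set gT}).
Hypothesis hN : reflection_cocycle S N.

(** Taking the whole arrangement as subarrangement turns proj_mx_descent_mul
    into Solomon's multiplication rule. *)
Lemma id_projection : cocycle_projection S N S setT id.
Proof.
split=> //; [exact: subset_gen | by rewrite normT subsetT |].
by case: hN => h1 h2 h3; split=> // [s Ss | x y Gx Gy t]; rewrite !setIT; auto.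
Qed.

Lemma proj_mx_id K : proj_mx S id (descent_elt S K) = descent_elt S K.
Proof. by rewrite proj_mx_descent. Qed.

Lemma descent_elt_mul (K L : {set gT}) : K \subset S -> L \subset S ->
  descent_elt S L *m descent_elt S K
    = \sum_(d in double_min_reps S N K L) descent_elt S (K :&: <<L>> :^ d^-1).
Proof.
move=> sKS sLS; have := proj_mx_descent_mul hN id_projection sKS sLS.
by rewrite !proj_mx_id; under eq_bigr do rewrite proj_mx_id.
Qed.

Lemma descent_elt_in (K : {set gT}) :
  K \subset S -> descent_elt S K \in descent_algebra S.
Proof. by move=> sKS; apply/memv_span/image_f; rewrite powersetE. Qed.

Lemma descent_ind (P : 'M[rat]_#|<<S>>| -> Prop) :
  P 0 -> (forall a u v, P u -> P v -> P (a *: u + v)) ->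
  (forall K : {set gT}, K \subset S -> P (descent_elt S K)) ->
  {in descent_algebra S, forall u, P u}.
Proof.
move=> P0 Plin PK; apply: span_ind => // u /imageP[K].
by rewrite powersetE => sKS ->; apply: PK.
Qed.

Lemma descent_eltS : descent_elt S S = 1%:M.
Proof.
rewrite -(repr_mx1 (regular_repr rat <<S>>)) /descent_elt /gset_mx.
rewrite (_ : min_reps S S S = [set 1%g]) ?big_set1 //.
apply/setP=> x; rewrite in_set1.
apply/(min_repsP hN (subxx S) _ (subxx S) (subxx S))/eqP.
  case=> Gx minx; apply/eqP; apply: contraT => /(left_descent hN Gx)[s Ss Ns].
  by have := minx s Ns; rewrite (groupJ (mem_gen Ss) Gx).
by move=> ->; split=> // t; rewrite (cocycle1 hN).
Qed.

Lemma descent_subalgebra : is_subalgebra (descent_algebra S).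
Proof.
split=> [|u v Au Av]; first by rewrite -descent_eltS descent_elt_in.
elim/descent_ind: u / Au => [|a u1 u2 IH1 IH2|L sLS].
- by rewrite mul0mx mem0v.
- by rewrite mulmxDl -scalemxAl rpredD ?rpredZ.
elim/descent_ind: v / Av => [|a u1 u2 IH1 IH2|K sKS].
- by rewrite mulmx0 mem0v.
- by rewrite mulmxDr -scalemxAr rpredD ?rpredZ.
rewrite descent_elt_mul //; apply: rpred_sum => d _; apply: descent_elt_in.
exact: subset_trans (subsetIl _ _) sKS.
Qed.

Section Morphism.

Variables (S' T' : {set gT}) (p : gT -> gT).
Hypothesis hp : cocycle_projection S N S' T' p.

(** On basis elements both sides have the same expansion, since the index set
    and the types in Solomon's rule do not depend on the projection. *)
Lemma proj_mxM : {in descent_algebra S &, forall u v,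
  proj_mx S' p (u *m v) = proj_mx S' p u *m proj_mx S' p v}.
Proof.
move=> u v Au Av.
elim/descent_ind: u / Au => [|a u1 u2 IH1 IH2|L sLS].
- by rewrite mul0mx !linear0 mul0mx.
- by rewrite mulmxDl -scalemxAl !linearP /= mulmxDl -scalemxAl IH1 IH2.
elim/descent_ind: v / Av => [|a u1 u2 IH1 IH2|K sKS].
- by rewrite !linear0.
- by rewrite !linearP /= IH1 IH2.
by rewrite (proj_mx_descent_mul hN hp) // descent_elt_mul // linear_sum.
Qed.

Lemma proj_mx1 : proj_mx S' p (1%:M : 'M_#|<<S>>|) = 1%:M.
Proof.
rewrite -(repr_mx1 (regular_repr rat <<S>>)) proj_mx_repr //.
by rewrite (proj_id hp) // repr_mx1.
Qed.

End Morphism.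

End Solomon.

Theorem proposition5p3 (gT : finGroupType) (W : {group gT}) (S I J : {set gT})
    (hcox : coxeter_system W S) (hS : S = I :|: J)
    (hconj : forall s t : gT, s \in I -> t \in J -> t \notin (s ^: W)%g) :
  exists2 Res : 'Hom(subvs_of (descent_algebra S),
                     subvs_of (descent_algebra (tilde_gens I J))),
    unique (@is_tilde_res gT I J S) Res & is_algebra_morphism Res.
Proof.
have [defW _ _] := hcox; have [N hN] := coxeter_cocycle hcox.
have hconj' s t : s \in I -> t \in J -> t \notin (s ^: <<S>>)%g.
  by rewrite defW; apply: hconj.
have hp := tilde_projP hN hS hconj'; set p := tilde_proj S I J N in hp.
set J' := tilde_gens I J in hp *.
have hJ' := tilde_cocycle hN hS hconj'.
have projE (K : {set gT}) : K \subset S -> proj_mx J' p (descent_elt S K)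
    = \sum_(d in min_reps S I (I :&: K))
        descent_elt J' (J' :&: (<<K>> :^ d^-1)%g).
  move=> sKS; rewrite proj_mx_descent.
  exact: (sum_tilde_proj hN hS hconj' sKS (regular_repr rat <<J'>>)).
have proj_in :
    {in descent_algebra S, forall u, proj_mx J' p u \in descent_algebra J'}.
  apply: descent_ind => [|a u v Bu Bv|K sKS]; first by rewrite linear0 mem0v.
    by rewrite linearP rpredD ?rpredZ.
  rewrite projE //; apply: rpred_sum => d _; apply: descent_elt_in.
  exact: subsetIl.
pose Res : 'Hom(subvs_of (descent_algebra S), subvs_of (descent_algebra J')) :=
  linfun (vsproj (descent_algebra J') \o proj_mx J' p \o vsval).
have ResE u : u \in descent_algebra S ->
    vsval (Res (vsproj (descent_algebra S) u)) = proj_mx J' p u.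
  by move=> Au; rewrite lfunE /= vsprojK // !vsprojK ?proj_in.
exists Res; first split.
- by move=> K sKS; rewrite ResE ?descent_elt_in ?projE.
- move=> f fE; apply/lfunP=> a; apply/val_inj; rewrite -[a]vsvalK.
  have: vsval a \in descent_algebra S by apply: subvsP.
  elim/descent_ind: (vsval a) / => [|c u v IHu IHv|K sKS].
  + by rewrite !linear0.
  + by rewrite !linearP /= IHu IHv.
  apply: etrans (esym (fE K sKS)); apply: etrans (projE K sKS).
  exact: ResE (descent_elt_in sKS).
have [A1 AM] := descent_subalgebra hN.
split.
- by split; [exact: descent_subalgebra hN | exact: descent_subalgebra hJ'].
- by rewrite ResE // (proj_mx1 hp).
by move=> u v Au Av; rewrite !ResE ?AM // (proj_mxM hN hp).
Qed.
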